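(* Let $\mathcal A$ be a Banach operator ideal. The Banach Lipschitz operator ideal $\mathrm{Lip}_0\circ\mathcal A^{\min}\circ\mathrm{Lip}_0$ is not of composition type.
   Context: Banach spaces are real; $\mathcal L(E,F)$ is the space of bounded linear operators and $\overline{\mathcal F}(E,F)$ the operator-norm closure of the finite-rank operators (approximable operators). A Banach operator ideal $\mathcal A$ is a Banach ideal of bounded linear operators in the sense of Pietsch, with norm $\|\cdot\|_{\mathcal A}$. Its minimal kernel is $\mathcal A^{\min}=\overline{\mathcal F}\circ\mathcal A\circ\overline{\mathcal F}$, i.e. operators $T=R\circ S\circ U$ with $U,R$ approximable and $S\in\mathcal A$, with norm $\inf\|R\|\|S\|_{\mathcal A}\|U\|$. A pointed metric space has a distinguished point $0$ (for a Banach space, its origin). $\mathrm{Lip}_0(X,Y)$ is the set of Lipschitz maps $f\colon X\to Y$ with $f(0)=0$, and $\mathrm{Lip}(f)$ is the least Lipschitz constant. For a Banach operator ideal $\mathcal B$, a pointed metric space $X$ and a Banach space $E$: $\mathcal B\circ\mathrm{Lip}_0(X,E)$ is the set of $f=T\circ g$ with $G$ a Banach space, $g\in\mathrm{Lip}_0(X,G)$, $T\in\mathcal B(G,E)$, with norm $\inf\|T\|_{\mathcal B}\mathrm{Lip}(g)$; $\mathrm{Lip}_0\circ\mathcal B\circ\mathrm{Lip}_0(X,E)$ is the set of $f=g_2\circ T\circ g_1$ with $G_1,G_2$ Banach spaces, $g_1\in\mathrm{Lip}_0(X,G_1)$, $T\in\mathcal B(G_1,G_2)$, $g_2\in\mathrm{Lip}_0(G_2,E)$,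 with norm $\inf\mathrm{Lip}(g_1)\|T\|_{\mathcal B}\mathrm{Lip}(g_2)$. Both are Banach Lipschitz operator ideals (classes of base-point preserving Lipschitz maps from pointed metric spaces to Banach spaces, with complete norms, stable under composition with $\mathrm{Lip}_0$ maps on the right and bounded linear operators on the left). Such an ideal $\mathcal I$ is of composition type if there exists a Banach operator ideal $\mathcal B$ with $\mathcal I=\mathcal B\circ\mathrm{Lip}_0$ (equal components for all $X,E$, and equal norms). *)

(* Defs.v *)
From HB Require Import structures.
From mathcomp Require Import all_boot all_order all_algebra.
From mathcomp Require Import all_classical all_reals all_analysis.

Set Implicit Arguments.
Unset Strict Implicit.
Unset Printing Implicit Defensive.

Import Order.TTheory GRing.Theory Num.Theory.
Import numFieldNormedType.Exports.

Local Open Scope classical_set_scope.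
Local Open Scope ring_scope.

(* The base point is a separate field rather than [point] because nothing
   forces the [point] of a normed module to be its origin. *)
Record pointed_metric (R : realType) := PointedMetric {
  pm_space :> metricType R ;
  pm_base : pm_space
}.

(* MathComp-Analysis does not equip normed modules with a [metricType]
   structure; we add the distance induced by the norm. *)
Section NormMetric.
Variables (R : realType) (E : normedModType R).

Let dist (x y : E) : R := `|y - x|.

Let dist_ge0 x y : 0 <= dist x y.
Proof. exact: normr_ge0. Qed.

Let dist_positivity x y : dist x y = 0 -> x = y.
Proof. by move/normr0_eq0/eqP; rewrite subr_eq0 => /eqP. Qed.

Let ballEdist x d : ball x d = [set y | dist x y < d].
Proof.
by rewrite -ball_normE; apply/seteqP; split=> y; rewrite /ball_ /dist /= distrC.
Qed.

Definition norm_metric : metricType R :=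
  HB.pack (NormedModule.sort E) (PseudoMetric.on E)
    (PseudoMetric_isMetric.Build R E dist_ge0 dist_positivity ballEdist).

End NormMetric.

Definition banach_pm (R : realType) (E : completeNormedModType R) :
  pointed_metric R := @PointedMetric R (norm_metric E) (0 : E).

Section Lipschitz.
Variables (R : realType) (X Y : pointed_metric R).

Definition lip_const (f : X -> Y) : set R :=
  [set k | 0 <= k /\ forall x y, mdist (f x) (f y) <= k * mdist x y].

Definition lip0 : set (X -> Y) :=
  [set f | lip_const f !=set0 /\ f (pm_base X) = pm_base Y].

Definition lip_cst (f : X -> Y) : R := inf (lip_const f).

End Lipschitz.

Section Operators.
Variables (R : realType) (E F : completeNormedModType R).

Definition bounded_operator : set (E -> F) :=
  [set T | linear T /\ bounded_fun_norm T].

Definition opnorm (T : E -> F) : R := sup [set `|T x| | x in [set x | `|x| <= 1]].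

Definition finite_rank : set (E -> F) :=
  [set T | bounded_operator T /\
    exists n (v : 'I_n -> F), forall x, exists c : 'I_n -> R,
      T x = \sum_i c i *: v i].

Definition approximable : set (E -> F) :=
  [set T | bounded_operator T /\
    forall e, 0 < e -> exists2 S, finite_rank S & opnorm (T \- S) < e].

End Operators.

(* A class of maps between Banach spaces with a real number attached to each
   map; the number is meaningful on members of the class only. *)
Record op_class (R : realType) := OpClass {
  op_mem : forall E F : completeNormedModType R, set (E -> F) ;
  op_norm : forall E F : completeNormedModType R, (E -> F) -> R
}.

(* Pietsch's axioms. The remaining properties of a norm on a linear space, and
   [opnorm T <= op_norm A T], follow from the ideal property and from the
   normalization at the identity of the scalar field. *)
Record banach_operator_ideal (R : realType) (A : op_class R) : Prop := {
  ideal_bounded : forall (E F : completeNormedModType R),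
    @op_mem R A E F `<=` @bounded_operator R E F ;
  ideal_id : op_mem A (@id R) ;
  ideal_add : forall (E F : completeNormedModType R) (S T : E -> F),
    op_mem A S -> op_mem A T -> op_mem A (S \+ T) ;
  ideal_comp : forall (E0 E F F0 : completeNormedModType R)
    (U : E0 -> E) (S : E -> F) (V : F -> F0),
    bounded_operator U -> op_mem A S -> bounded_operator V ->
    op_mem A (V \o S \o U) ;
  ideal_norm_ge0 : forall (E F : completeNormedModType R) (S : E -> F),
    op_mem A S -> 0 <= op_norm A S ;
  ideal_norm_id : op_norm A (@id R) = 1 ;
  ideal_norm_add : forall (E F : completeNormedModType R) (S T : E -> F),
    op_mem A S -> op_mem A T ->
    op_norm A (S \+ T) <= op_norm A S + op_norm A T ;
  ideal_norm_comp : forall (E0 E F F0 : completeNormedModType R)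
    (U : E0 -> E) (S : E -> F) (V : F -> F0),
    bounded_operator U -> op_mem A S -> bounded_operator V ->
    op_norm A (V \o S \o U) <= opnorm V * op_norm A S * opnorm U ;
  ideal_complete : forall (E F : completeNormedModType R) (S : nat -> E -> F),
    (forall n, op_mem A (S n)) ->
    (forall e, 0 < e -> exists N, forall m n, (N <= m)%N -> (N <= n)%N ->
      op_norm A (S m \- S n) < e) ->
    exists2 T, op_mem A T &
      op_norm A (S n \- T) @[n --> \oo] --> (0 : R)
}.

(* Here and below, a map is in the composed class iff its set of factorization
   costs is nonempty, and its norm is the infimum of that set. *)
Section MinimalKernel.
Variables (R : realType) (A : op_class R).

Definition min_costs (E F : completeNormedModType R) (T : E -> F) : set R :=
  [set r | exists (G1 G2 : completeNormedModType R)
      (U : E -> G1) (S : G1 -> G2) (V : G2 -> F),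
    [/\ approximable U, op_mem A S, approximable V, T = V \o S \o U &
        r = opnorm V * op_norm A S * opnorm U]].

Definition minimal_kernel : op_class R :=
  OpClass (fun E F => [set T : E -> F | min_costs T !=set0])
          (fun E F T => inf (min_costs T)).

End MinimalKernel.

Record lip_class (R : realType) := LipClass {
  lip_mem : forall (X : pointed_metric R) (E : completeNormedModType R),
    set (X -> E) ;
  lip_norm : forall (X : pointed_metric R) (E : completeNormedModType R),
    (X -> E) -> R
}.

Section LipschitzClasses.
Variables (R : realType) (B : op_class R).

Definition op_lip_costs (X : pointed_metric R) (E : completeNormedModType R)
    (f : X -> E) : set R :=
  [set r | exists (G : completeNormedModType R) (g : X -> G) (T : G -> E),
    [/\ lip0 (Y := banach_pm G) g, op_mem B T, f = T \o g &
        r = op_norm B T * lip_cst (Y := banach_pm G) g]].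

Definition op_lip : lip_class R :=
  LipClass (fun X E => [set f : X -> E | op_lip_costs f !=set0])
           (fun X E f => inf (op_lip_costs f)).

Definition lip_op_lip_costs (X : pointed_metric R)
    (E : completeNormedModType R) (f : X -> E) : set R :=
  [set r | exists (G1 G2 : completeNormedModType R)
      (g1 : X -> G1) (T : G1 -> G2) (g2 : G2 -> E),
    [/\ lip0 (Y := banach_pm G1) g1, op_mem B T,
        lip0 (X := banach_pm G2) (Y := banach_pm E) g2, f = g2 \o T \o g1 &
        r = lip_cst (Y := banach_pm G1) g1 * op_norm B T *
            lip_cst (X := banach_pm G2) (Y := banach_pm E) g2]].

Definition lip_op_lip : lip_class R :=
  LipClass (fun X E => [set f : X -> E | lip_op_lip_costs f !=set0])
           (fun X E f => inf (lip_op_lip_costs f)).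

End LipschitzClasses.

Definition composition_type (R : realType) (I : lip_class R) : Prop :=
  exists B : op_class R,
    [/\ banach_operator_ideal B,
        forall (X : pointed_metric R) (E : completeNormedModType R),
          @lip_mem R I X E = @lip_mem R (op_lip B) X E &
        forall (X : pointed_metric R) (E : completeNormedModType R)
            (f : X -> E), lip_mem I f ->
          lip_norm I f = lip_norm (op_lip B) f].

(* Main.v *)
(* The Lipschitz curve [c : t |-> (min (|t|, 2^-n))_n] from the line to
   l_infinity belongs to the ideal, since the identity of the line is
   approximable. If the ideal were [B o Lip_0], then [c = T o h] with [T] linear
   in [B] and [h] Lipschitz; as [T = T o id] is again in [B o Lip_0], it would
   factor as a Lipschitz map after an approximable operator after a Lipschitz
   map, hence map bounded sets to totally bounded ones. But [T] sends the bounded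
   sequence [2^k h(2^-k)] to the difference quotients [2^k c(2^-k)], whose mutual
   distances are at least 1/2. *)
Require Import Defs.
From HB Require Import structures.
From mathcomp Require Import all_boot all_order all_algebra.
From mathcomp Require Import all_classical all_reals all_analysis.
From mathcomp Require Import lra.

Set Implicit Arguments.
Unset Strict Implicit.
Unset Printing Implicit Defensive.

Import Order.TTheory GRing.Theory Num.Theory.
Import numFieldNormedType.Exports.

Local Open Scope classical_set_scope.
Local Open Scope ring_scope.

(** * The Banach space of bounded real sequences *)

Section BoundedSequences.
Variable R : realType.

Definition bounded_seq : {pred nat -> R} :=
  [pred x | `[< exists M, forall n, `|x n| <= M >]].

Lemma bounded_seq_submod_closed : submod_closed bounded_seq.
Proof.
split=> [|a x y /asboolP[M xM] /asboolP[N yN]]; apply/asboolP.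
  by exists 0 => n; rewrite normr0.
exists (`|a| * M + N) => n.
by rewrite (le_trans (ler_normD _ _))// lerD// normrM ler_wpM2l.
Qed.

HB.instance Definition _ :=
  GRing.isSubmodClosed.Build R (nat -> R) bounded_seq bounded_seq_submod_closed.

Record linf := Linf { linf_val :> nat -> R ; _ : linf_val \in bounded_seq }.

HB.instance Definition _ := [isSub for linf_val].
HB.instance Definition _ := [Choice of linf by <:].
HB.instance Definition _ := [SubChoice_isSubLmodule of linf by <:].

Definition linf_norm (x : linf) : R := sup (range (fun n => `|x n|)).

Lemma linf_has_sup (x : linf) : has_sup (range (fun n => `|x n|)).
Proof.
split; first by exists `|x 0%N|, 0%N.
by have /asboolP[M xM] := valP x; exists M => _ [n _ <-].
Qed.

Lemma linf_norm_ub (x : linf) n : `|x n| <= linf_norm x.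
Proof. by apply: sup_upper_bound; [exact: linf_has_sup|exists n]. Qed.

Lemma linf_norm_le (x : linf) M : (forall n, `|x n| <= M) -> linf_norm x <= M.
Proof.
by move=> xM; apply: ge_sup => [|_ [n _ <-]//]; case: (linf_has_sup x).
Qed.

Lemma linf_normD x y : linf_norm (x + y) <= linf_norm x + linf_norm y.
Proof.
apply: linf_norm_le => n.
by rewrite (le_trans (ler_normD _ _))// lerD// linf_norm_ub.
Qed.

Lemma linf_normZ a x : linf_norm (a *: x) = `|a| * linf_norm x.
Proof.
have le b y : linf_norm (b *: y) <= `|b| * linf_norm y.
  by apply: linf_norm_le => n; rewrite normrM ler_wpM2l// linf_norm_ub.
apply/eqP; rewrite eq_le le/=.
have [->|a0] := eqVneq a 0.
  by rewrite normr0 mul0r (le_trans (normr_ge0 _) (linf_norm_ub _ 0%N)).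
(* The reverse inequality is [le] for the scalar [a^-1] and the vector [a *: x]. *)
rewrite -[x in leLHS](scalerK a0) (le_trans (ler_wpM2l _ (le _ _)))//.
by rewrite mulrA -normrM divff// normr1 mul1r.
Qed.

Lemma linf_norm0_eq0 x : linf_norm x = 0 -> x = 0.
Proof.
move=> x0; apply/val_inj/funext => n; apply/normr0_eq0/eqP.
by rewrite eq_le normr_ge0 andbT -x0 linf_norm_ub.
Qed.

HB.instance Definition _ :=
  Lmodule_isNormed.Build R linf linf_normD linf_normZ linf_norm0_eq0.

Lemma linf_dist_coord (x y : linf) n : `|x n - y n| <= `|x - y|.
Proof. exact: (linf_norm_ub (x - y) n). Qed.

(** The limit is taken coordinate by coordinate. The Cauchy estimates do not depend on the
    coordinate, so they survive in the sup norm. *)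
Lemma linf_complete (F : set_system linf) :
  ProperFilter F -> cauchy F -> cvg F.
Proof.
move=> FF /cauchyP Fc.
have ev_cauchy n : cauchy ((fun x : linf => x n) @ F).
  apply/cauchyP => e e0; have [x xF] := Fc e e0; exists (x n).
  apply: (@filterS _ F _ _ _ _ xF) => y; rewrite -!ball_normE/=.
  exact/le_lt_trans/linf_dist_coord.
pose l n : R := lim ((fun x : linf => x n) @ F).
have l_cvg n : (fun x : linf => x n) @ F --> l n by exact: R_complete.
(* The auxiliary [y] lies in the ball and has its coordinate [n] within [d] of [l n]; it may depend
   on [n], but the resulting bound does not. *)
have near_l e (x : linf) : F (ball x e) -> forall n, `|x n - l n| <= e.
  move=> Fx n; apply/ler_addgt0Pl => d d0.
  have /cvgrPdist_lt/(_ _ d0) ly := l_cvg n.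
  have [y [xy /= lyd]] := filter_ex (filterI Fx ly).
  rewrite -(subrKA (y n)) addrC (le_trans (ler_normD _ _))// lerD//.
    by rewrite distrC ltW.
  move: xy; rewrite -ball_normE/= => /ltW; apply: le_trans.
  exact: linf_dist_coord.
have lb : l \in bounded_seq.
  have [x /near_l xl] := Fc 1 ltr01; apply/asboolP.
  have /asboolP[M xM] := valP x; exists (1 + M) => n.
  by rewrite -[l n](subrK (x n)) (le_trans (ler_normD _ _))// lerD// distrC.
apply/cvg_ex; exists (Linf lb); apply/cvgrPdist_le => /= e e0.
have [x Fx] := Fc (e / 2) (divr_gt0 e0 (ltr0Sn _ _)).
apply: filterS (Fx) => y; rewrite -ball_normE/= => xy.
rewrite -(subrKA x) (le_trans (ler_normD _ _))// [e]splitr lerD ?(ltW xy)//.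
by apply: linf_norm_le => n; rewrite [X in `|X|]/= distrC near_l.
Qed.

HB.instance Definition _ := Uniform_isComplete.Build linf linf_complete.

End BoundedSequences.

(** * Total boundedness in finite dimension, stated through sequences *)

Lemma compact_close_terms (R : realType) (V : normedModType R) (K : set V)
    (u : nat -> V) (e : R) :
  compact K -> (forall k, K (u k)) -> 0 < e ->
  exists i j, (i < j)%N /\ `|u i - u j| < e.
Proof.
move=> cK uK e0.
(* Terms of arbitrarily large index come within [e / 2] of a cluster point [p]; two such terms with
   distinct indices are enough. *)
have [|p [_ clp]] := cK (u @ \oo) _; first by exists 0%N => // n _; exact: uK.
have close N : exists2 n, (N <= n)%N & `|p - u n| < e / 2.
  have := clp (u @` [set n | (N <= n)%N]) (ball p (e / 2)).
  case=> [||_ [[n Nn <-]]].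
  - by exists N => // n Nn; exists n.
  - apply: nbhsx_ballx; exact: divr_gt0.
  by rewrite -ball_normE/= => pn; exists n.
have [i _ pi] := close 0%N; have [j ij pj] := close i.+1.
exists i, j; split=> //.
rewrite -(subrKA p) (le_lt_trans (ler_normD _ _))// [e]splitr ltrD//.
by rewrite distrC.
Qed.

Section Combinations.
Variables (R : realType) (V : normedModType R).

Definition lincomb n (v : 'I_n -> V) (c : 'rV[R]_n) : V :=
  \sum_i c ord0 i *: v i.

Lemma lincombZ n (v : 'I_n -> V) a c : lincomb v (a *: c) = a *: lincomb v c.
Proof.
by rewrite /lincomb scaler_sumr; apply: eq_bigr => i _; rewrite mxE scalerA.
Qed.

Lemma lincomb_continuous n (v : 'I_n -> V) : continuous (lincomb v).
Proof.
apply: (@continuous_big V 'I_n +%R 0 predT _ 'rV[R]_n _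
  (fun i c => c ord0 i *: v i)) => [|i _ c]; first exact: add_continuous.
exact: (cvgZ (@coord_continuous R 1 n ord0 i c) (cvg_cst (v i))).
Qed.

(** The constant is the minimum of the norm of [lincomb v] on the compact unit sphere of
    coefficients, positive because the family is free. *)
Lemma lincomb_coercive n (v : 'I_n -> V) :
  (forall c, lincomb v c = 0 -> c = 0) ->
  exists2 m, 0 < m & forall c, m * `|c| <= `|lincomb v c|.
Proof.
move=> v_free; pose S : set 'rV[R]_n := [set c | `|c| = 1].
have [[c0 Sc0]|S0] := pselect (S !=set0); last first.
  (* With an empty sphere the only coefficient vector is 0, so any positive constant works. *)
  exists 1 => // c; have [->|c0] := eqVneq c 0; first by rewrite normr0 mulr0.
  case: S0; exists (`|c|^-1 *: c); rewrite /S/= normrZ normfV normr_id mulVf//.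
  by rewrite normr_eq0.
have cS : compact S.
  apply: bounded_closed_compact.
    by exists 1; split=> // x x1 c /= ->; exact: ltW.
  have -> : S = Num.norm @^-1` [set 1] by [].
  by apply: closed_comp => [? _|]; [exact: norm_continuous|exact: closed_eq].
have [|c Sc cmin] := compact_EVT_min (f := Num.norm \o lincomb v)
    (ex_intro _ c0 Sc0) cS.
  apply: continuous_subspaceT => x; apply: continuous_comp.
    exact: lincomb_continuous.
  exact: norm_continuous.
exists `|lincomb v c|.
  rewrite normr_gt0; apply/eqP => /v_free c_0.
  by move: Sc; rewrite inE /S/= c_0 normr0 => /esym/eqP; rewrite oner_eq0.
move=> d; have [->|d0] := eqVneq d 0; first by rewrite normr0 mulr0.
have dn : `|d| != 0 by rewrite normr_eq0.
have Sd : `|d|^-1 *: d \in S.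
  by rewrite inE /S/= normrZ normfV normr_id mulVf.
rewrite -ler_pdivlMr ?normr_gt0// [leRHS]mulrC.
by have := cmin _ Sd; rewrite /= lincombZ normrZ normfV normr_id.
Qed.

(** Induction on the number of vectors. For a free family, coercivity confines the coefficients to a
    compact ball; otherwise one vector is eliminated. Bounding the combinations rather than the
    coefficients lets the hypothesis pass through the elimination. *)
Lemma lincomb_close_terms n (v : 'I_n -> V) (c : nat -> 'rV[R]_n) (M e : R) :
  (forall k, `|lincomb v (c k)| <= M) -> 0 < e ->
  exists i j, (i < j)%N /\ `|lincomb v (c i) - lincomb v (c j)| < e.
Proof.
elim: n v c => [|n IH] v c cM e0.
  by exists 0%N, 1%N; rewrite /lincomb !big_ord0 subr0 normr0.
have [v_free|] := pselect (forall d, lincomb v d = 0 -> d = 0).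
  have [m m0 mc] := lincomb_coercive v_free.
  pose B : set 'rV[R]_n.+1 := [set d | `|d| <= M / m].
  apply: (compact_close_terms (K := lincomb v @` B)) => // [|k].
    apply: continuous_compact.
      by apply: continuous_subspaceT; exact: lincomb_continuous.
    apply: bounded_closed_compact.
      exists (M / m); split=> [|x Mx d dM]; first exact: num_real.
      exact: le_trans dM (ltW Mx).
    have -> : B = Num.norm @^-1` [set x | x <= M / m] by [].
    by apply: closed_comp => [? _|]; [exact: norm_continuous|exact: closed_le].
  by exists (c k) => //; rewrite /B/= ler_pdivlMr// mulrC (le_trans (mc _)).
move=> /existsNP[d /not_implyP[d0 /eqP dn0]].
have [i di] : exists i, d ord0 i != 0.
  apply/existsP; apply: contraNT dn0; rewrite negb_exists => /forallP dE.
  by apply/eqP/rowP => i; rewrite mxE; apply/eqP/negPn/dE.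
have vi : v i = \sum_j (- (d ord0 i)^-1 * d ord0 (lift i j)) *: v (lift i j).
  move: d0; rewrite /lincomb (bigD1_ord i)//= => /eqP; rewrite addr_eq0 => /eqP.
  move=> /(congr1 (fun x => (d ord0 i)^-1 *: x)); rewrite scalerK// => ->.
  rewrite scalerN scaler_sumr -sumrN; apply: eq_bigr => j _.
  by rewrite scalerA mulNr scaleNr.
(* The coefficients of the same vector once [v i] is replaced by its expression in the others. *)
pose c' k : 'rV[R]_n := \row_j (c k ord0 (lift i j)
  - c k ord0 i * (d ord0 i)^-1 * d ord0 (lift i j)).
have c'E k : lincomb v (c k) = lincomb (v \o lift i) (c' k).
  rewrite /lincomb (bigD1_ord i)//= {1}vi scaler_sumr -big_split/=.
  apply: eq_bigr => j _; rewrite mxE scalerA -scalerDl; congr (_ *: _).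
  by rewrite addrC mulNr mulrN mulrA.
have [k|p [q [pq cpq]]] := IH (v \o lift i) c' _ e0; first by rewrite -c'E.
by exists p, q; rewrite !c'E.
Qed.

End Combinations.

(** * Bounded and approximable operators *)

Section Operators.
Variable R : realType.
Implicit Types E F : completeNormedModType R.

Lemma lip0_banachP E F (f : E -> F) :
  lip0 (X := banach_pm E) (Y := banach_pm F) f <->
  (exists2 k, 0 <= k & forall x y, `|f x - f y| <= k * `|x - y|) /\ f 0 = 0.
Proof.
split=> -[fk f0]; split=> //.
  by case: fk => k [k0 fk]; exists k => // x y; exact: fk.
by case: fk => k k0 fk; exists k; split=> // x y; exact: fk.
Qed.

Lemma lip0_id E : lip0 (X := banach_pm E) (Y := banach_pm E) id.
Proof. by apply/lip0_banachP; split=> //; exists 1 => // x y; rewrite mul1r. Qed.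

Lemma linear_le_on_ball E F (T : E -> F) M : linear T ->
  (forall x, `|x| <= 1 -> `|T x| <= M) -> forall x, `|T x| <= M * `|x|.
Proof.
move=> Tl TM x; have [->|x0] := eqVneq x 0.
  have := zmod_morphism_linear Tl 0 0; rewrite !subrr => ->.
  by rewrite !normr0 mulr0.
have nx0 : `|x| != 0 by rewrite normr_eq0.
rewrite -ler_pdivrMr ?normr_gt0// mulrC.
have := TM (`|x|^-1 *: x); rewrite (scalable_linear Tl) !normrZ normfV normr_id.
by apply; rewrite mulVf.
Qed.

Lemma bounded_operator_lip E F (T : E -> F) : bounded_operator T ->
  exists2 k, 0 <= k & forall x y, `|T x - T y| <= k * `|x - y|.
Proof.
move=> [Tl /(_ 1)[M TM]]; exists M.
  by rewrite (le_trans _ (TM 0 _))// normr0.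
move=> x y; rewrite -(zmod_morphism_linear Tl); exact: linear_le_on_ball.
Qed.

Lemma bounded_operatorB E F (S T : E -> F) :
  bounded_operator S -> bounded_operator T -> bounded_operator (S \- T).
Proof.
move=> [Sl Sb] [Tl Tb]; split=> [a x y|r].
  by rewrite /= Sl Tl scalerBr opprD addrACA.
have [M SM] := Sb r; have [N TN] := Tb r; exists (M + N) => x xr.
by rewrite (le_trans (ler_normB _ _))// lerD ?SM ?TN.
Qed.

Lemma opnorm_ub E F (T : E -> F) x :
  bounded_operator T -> `|T x| <= opnorm T * `|x|.
Proof.
move=> [Tl /(_ 1)[M TM]]; apply: linear_le_on_ball => // {}x x1.
apply: sup_upper_bound; last by exists x.
split; first by exists `|T x|, x.
by exists M => _ [y y1 <-]; exact: TM.
Qed.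

(** This is the compactness of [U]: a finite-rank [S] close to [U] sends [z] to a bounded sequence
    of combinations of finitely many vectors, which has two close terms. *)
Lemma approximable_close_terms E F (U : E -> F) (z : nat -> E) (M e : R) :
  approximable U -> (forall k, `|z k| <= M) -> 0 < e ->
  exists i j, (i < j)%N /\ `|U (z i) - U (z j)| < e.
Proof.
move=> [Ub Ua] zM e0; have M0 : 0 <= M := le_trans (normr_ge0 _) (zM 0%N).
(* Chosen so that [d * M <= e / 4]; the [+ 1] covers [M = 0]. The error budget is [e / 4] at each
   end and [e / 2] between the images under [S]. *)
pose d := e / 4 / (M + 1).
have d0 : 0 < d by rewrite !divr_gt0// ltr_wpDl.
have [S [Sb [n [v Sv]]] USd] := Ua d d0.
have [k Sk] := choice (fun k => Sv (z k)).
pose c k0 : 'rV[R]_n := \row_i k k0 i.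
have cE k0 : lincomb v (c k0) = S (z k0).
  by rewrite Sk; apply: eq_bigr => i _; rewrite mxE.
have [K K0 SK] := bounded_operator_lip Sb.
have S0 : S 0 = 0.
  by have := zmod_morphism_linear Sb.1 0 0; rewrite !subrr.
have [k0||i [j [ij cij]]] := @lincomb_close_terms _ _ n v c (K * M) (e / 2).
- rewrite cE -[S _]subr0 -S0 (le_trans (SK _ _))// subr0.
  by rewrite ler_wpM2l.
- exact: divr_gt0.
exists i, j; split=> //; rewrite !cE in cij.
have near_S k0 : `|U (z k0) - S (z k0)| <= e / 4.
  rewrite (le_trans (opnorm_ub _ (bounded_operatorB Ub Sb)))//.
  rewrite (le_trans (ler_wpM2r _ (ltW USd)))//.
  rewrite (le_trans (ler_wpM2l _ (zM k0))) ?(ltW d0)//.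
  rewrite /d mulrAC ler_pdivrMr ?ltr_wpDl// ler_wpM2l ?divr_ge0 ?(ltW e0)//.
  by rewrite lerDl.
rewrite (_ : _ - _ = (U (z i) - S (z i)) + (S (z i) - S (z j))
  + (S (z j) - U (z j))); last by rewrite !addrA !subrK.
rewrite (le_lt_trans (ler_normD _ _))//.
have := ler_normD (U (z i) - S (z i)) (S (z i) - S (z j)).
have := near_S i; have := near_S j; rewrite [`|U (z j) - _|]distrC.
move: cij; lra.
Qed.

Lemma approximable_id : approximable (@id R).
Proof.
have idb : bounded_operator (@id R).
  by split=> // r; exists r.
(* The line is spanned by 1, so the identity has finite rank and approximates itself with error
   0. *)
split=> // e e0; exists id.
  split=> //; exists 1%N, (fun=> 1) => x; exists (fun=> x).
  by rewrite big_ord1 /GRing.scale/= mulr1.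
rewrite /opnorm (_ : image _ _ = [set 0]) ?sup1//.
apply/seteqP; split=> [_ [x _ <-]|_ ->]; first by rewrite /= subrr normr0.
by exists 0; rewrite /= ?subrr normr0.
Qed.

End Operators.

(** * A Lipschitz curve with separated difference quotients at 0 *)

Section Curve.
Variable R : realType.

Lemma curve_bounded (t : R) :
  (fun n => Num.min `|t| (2 ^- n)) \in @bounded_seq R.
Proof.
apply/asboolP; exists `|t| => n.
by rewrite ger0_norm ?ge_min ?lexx// le_min normr_ge0 invr_ge0 exprn_ge0.
Qed.

Definition curve (t : R) : linf R := Linf (curve_bounded t).

(** Absolute value and truncation at a constant are both 1-Lipschitz, so 1 is a Lipschitz constant
    for every coordinate. *)
Lemma curve_lip0 : lip0 (X := banach_pm R) (Y := banach_pm (linf R)) curve.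
Proof.
apply/lip0_banachP; split; last first.
  apply/val_inj/funext => n; rewrite /= normr0.
  by apply: min_l; rewrite invr_ge0 exprn_ge0.
exists 1 => // s t; rewrite mul1r; apply: linf_norm_le => n.
rewrite -[X in `|X|]/(Num.min `|s| (2 ^- n) - Num.min `|t| (2 ^- n)).
have := ler_dist_dist s t; set x := `|s|; set y := `|t|; set d := `|s - t|.
set a := 2 ^- n; rewrite !ler_norml.
by case: (leP x a) => ?; case: (leP y a) => ?; lra.
Qed.

(** Coordinate [j] suffices: there the quotient of index [j] equals 1, while that of index [i] is at
    most [2 ^+ i * 2 ^- j <= 1 / 2]. *)
Lemma curve_separated i j : (i < j)%N ->
  1 / 2 <= `|2 ^+ i *: curve (2 ^- i) - 2 ^+ j *: curve (2 ^- j)|.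
Proof.
move=> ij; rewrite distrC; apply: le_trans (linf_dist_coord _ _ j).
rewrite -[(2 ^+ j *: curve (2 ^- j)) j]/(2 ^+ j * Num.min `|2 ^- j| (2 ^- j)).
rewrite -[(2 ^+ i *: curve (2 ^- i)) j]/(2 ^+ i * Num.min `|2 ^- i| (2 ^- j)).
have p k : 0 < 2 ^+ k :> R by rewrite exprn_gt0.
have q k : 0 <= 2 ^- k :> R by rewrite invr_ge0 ltW.
rewrite (le_trans _ (ler_norm _))// !(ger0_norm (q _)) minxx mulfV ?gt_eqF//.
have ji : 2 ^+ i * 2 ^- j <= 1 / 2 :> R.
  rewrite ler_pdivrMr// mulrAC ler_pdivlMr// mulrC mul1r -exprS.
  by rewrite ler_eXn2l ?ltr1n.
have : 2 ^+ i * Num.min (2 ^- i) (2 ^- j) <= 2 ^+ i * 2 ^- j :> R.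
  by rewrite ler_wpM2l ?(ltW (p i))// ge_min lexx orbT.
by move: ji; lra.
Qed.

End Curve.

Theorem proposition2p13 (R : realType) (A : op_class R)
  (hA : banach_operator_ideal A) :
  ~ composition_type (lip_op_lip (minimal_kernel A)).
Proof.
move=> [B [hB memB _]].
have : lip_mem (lip_op_lip (minimal_kernel A)) (X := banach_pm R) (@curve R).
  (* All the nonlinearity goes into the outer map; the operator is the identity of the line, itself
     factored through three identities. *)
  eexists; exists R, R, id, id, (@curve R); split=> //.
  - exact: lip0_id.
  - eexists; exists R, R, id, id, id; split=> //.
    + exact: approximable_id.
    + exact: ideal_id.
    + exact: approximable_id.
  - exact: curve_lip0.
rewrite memB => -[_ [G [h [T [/lip0_banachP[[L L0 hL] h0] BT curveE _]]]]].
have : lip_mem (op_lip B) (X := banach_pm G) T.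
  by eexists; exists G, id, T; split=> //; exact: lip0_id.
rewrite -memB => -[_ [G1 [G2 [g1 [S [g2 [g1l Sm g2l TE _]]]]]]].
have [_ [H1 [H2 [U [S' [V [Ua AS' Va SE _]]]]]]] := Sm.
have [[k1 k10 g1k] g10] := (lip0_banachP _).1 g1l.
have [[k2 k20 g2k] _] := (lip0_banachP _).1 g2l.
have [kS kS0 S'k] := bounded_operator_lip (ideal_bounded hA AS').
have [kV kV0 Vk] := bounded_operator_lip Va.1.
have Tl := (ideal_bounded hB BT).1.
pose x k := 2 ^+ k *: h (2 ^- k).
(* Since [h] vanishes at 0, the norm of [h (2 ^- k)] is at most [L * 2 ^- k]. *)
have xL k : `|x k| <= L.
  rewrite normrZ ger0_norm ?exprn_ge0// -ler_pdivlMl ?exprn_gt0//.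
  have := hL (2 ^- k) 0; rewrite h0 !subr0 mulrC => /le_trans; apply.
  by rewrite ger0_norm// invr_ge0 exprn_ge0.
have xM k : `|g1 (x k)| <= k1 * L.
  by rewrite -[g1 _]subr0 -g10 (le_trans (g1k _ _))// subr0 ler_wpM2l.
(* A Lipschitz constant for everything applied after [U], namely [S'], [V] and [g2]. *)
pose K := k2 * (kV * kS).
have K0 : 0 <= K by rewrite !mulr_ge0.
(* Multiplying this tolerance by [K] leaves less than the separation [1 / 2]; [K + 1] avoids
   dividing by 0. *)
have [|i [j [ij]]] := approximable_close_terms (e := 1 / 2 / (K + 1)) Ua xM.
  by rewrite !divr_gt0// ltr_wpDl.
rewrite ltr_pdivlMr ?ltr_wpDl// => Uij.
have /idP := curve_separated R ij; rewrite leNgt => /negP; apply.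
(* Linearity of [T] is decisive here: the scaling moves inside, onto [h]. *)
have TxE k : 2 ^+ k *: curve (2 ^- k) = T (x k).
  by rewrite curveE /x (scalable_linear Tl).
rewrite !TxE TE SE /= (le_lt_trans _ Uij)//.
rewrite (le_trans (g2k _ _))// (le_trans (ler_wpM2l k20 (Vk _ _)))//.
rewrite (le_trans (ler_wpM2l k20 (ler_wpM2l kV0 (S'k _ _))))//.
by rewrite [leRHS]mulrC !mulrA -(mulrA k2) ler_wpM2r// lerDl.
Qed.
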